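(* (a) The index set $UHQ=\{e:\mathcal{A}_e\text{ is an ultrahomogeneous equivalence structure}\}$ is $\Pi^0_2$ complete, and in fact $\Pi^0_2$ complete relative to $EQ$. (b) The index set $WUQ=\{e:\mathcal{A}_e\text{ is a weakly ultrahomogeneous equivalence structure}\}$ is $\Sigma^0_3$ complete, and in fact $\Sigma^0_3$ complete relative to $EQ$.
   Context: $\{\varphi_e\}_{e\in\omega}$ is the standard enumeration of the partial computable functions. $\mathcal{A}_e=(\omega,\equiv_e)$ is the computable equivalence structure whose relation $\equiv_e$ has characteristic function $\varphi_e$ (via a standard coding of pairs), defined when $\varphi_e$ is total and is the characteristic function of an equivalence relation on $\omega$; $EQ=\{e:\mathcal{A}_e\text{ is an equivalence structure}\}$. An equivalence structure is ultrahomogeneous if every isomorphism between finite substructures extends to an automorphism; it is weakly ultrahomogeneous if there is a finite set $\{a_1,\dots,a_n\}$ of elements such that every isomorphism between finite substructures containing all $a_i$ and fixing each $a_i$ extends to an automorphism. For a class $\Gamma$ (such as $\Pi^0_2$ or $\Sigma^0_3$), a set $B\subseteq\omega$ is $\Gamma$ complete if $B\in\Gamma$ and for every $A\in\Gamma$ there is a computable $f$ with $i\in A\iff f(i)\in B$ for all $i$. For $B\subseteq C\subseteq\omega$, $B$ is $\Gamma$ complete relative to $C$ if $B=C\cap R$ for some $R\in\Gamma$ and for every $A\in\Gamma$ there is a computable $f$ with $f(i)\in C$ for all $i$ and $i\in A\iff f(i)\in B$ for all $i$. *)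

(* Defs.v *)
From Stdlib Require Import Arith List RelationClasses.
From Stdlib Require Cantor FinFun.
Import ListNotations.

Notation "⟨ x , y ⟩" := (Cantor.to_nat (x, y)) (at level 0, x, y at level 99).

(** The mu-recursive functions in Kleene's indexed presentation:
    [phi e x y] means that phi_e(x) is defined and equal to y.  All functions
    are unary, several arguments being packed with Cantor's pairing bijection.
    The first component of [e] selects the scheme (zero, successor, the two
    projections, pairing, composition, primitive recursion, minimization) and
    the second one carries the indices of the functions it is applied to; an
    index whose tag is at least 8 denotes the nowhere defined function. *)
Inductive phi : nat -> nat -> nat -> Prop :=
| phi_zero r x : phi ⟨0, r⟩ x 0
| phi_succ r x : phi ⟨1, r⟩ x (S x)
| phi_fst r x y : phi ⟨2, r⟩ ⟨x, y⟩ x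
| phi_snd r x y : phi ⟨3, r⟩ ⟨x, y⟩ y
| phi_pair a b x u v :
    phi a x u -> phi b x v -> phi ⟨4, ⟨a, b⟩⟩ x ⟨u, v⟩
| phi_comp a b x u v :
    phi b x u -> phi a u v -> phi ⟨5, ⟨a, b⟩⟩ x v
| phi_rec0 a b x u :
    phi a x u -> phi ⟨6, ⟨a, b⟩⟩ ⟨x, 0⟩ u
| phi_recS a b x n u v :
    phi ⟨6, ⟨a, b⟩⟩ ⟨x, n⟩ u -> phi b ⟨x, ⟨n, u⟩⟩ v ->
    phi ⟨6, ⟨a, b⟩⟩ ⟨x, S n⟩ v
| phi_mu a x n (w : nat -> nat) :
    (forall k, k < n -> phi a ⟨x, k⟩ (S (w k))) -> phi a ⟨x, n⟩ 0 ->
    phi ⟨7, a⟩ x n.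

Definition computable (f : nat -> nat) : Prop :=
  exists e, forall x, phi e x (f x).

Definition computable_set (A : nat -> Prop) : Prop :=
  exists f, computable f /\
    forall x, (A x /\ f x = 1) \/ (~ A x /\ f x = 0).

(** Arithmetical hierarchy of sets of natural numbers. *)
Fixpoint Sigma0 (n : nat) (A : nat -> Prop) : Prop :=
  match n with
  | 0 => computable_set A
  | S m => exists B, Pi0 m B /\ forall x, A x <-> exists y, B ⟨x, y⟩
  end
with Pi0 (n : nat) (A : nat -> Prop) : Prop :=
  match n with
  | 0 => computable_set A
  | S m => exists B, Sigma0 m B /\ forall x, A x <-> forall y, B ⟨x, y⟩
  end.

Definition complete (Gamma : (nat -> Prop) -> Prop) (B : nat -> Prop) : Prop :=
  Gamma B /\
  forall A, Gamma A ->
    exists f, computable f /\ forall i, A i <-> B (f i).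

Definition complete_relative (Gamma : (nat -> Prop) -> Prop)
    (B C : nat -> Prop) : Prop :=
  (exists R, Gamma R /\ forall i, B i <-> C i /\ R i) /\
  forall A, Gamma A ->
    exists f, computable f /\ (forall i, C (f i)) /\
      forall i, A i <-> B (f i).

(** Structures (T, E) with one binary relation.  The language is relational,
    so the finite substructures are the finite subsets, given by lists. *)
Definition sub_isomorphism {T : Type} (E : T -> T -> Prop)
    (X Y : list T) (f : T -> T) : Prop :=
  (forall x, In x X -> In (f x) Y) /\
  (forall y, In y Y -> exists x, In x X /\ f x = y) /\
  (forall x x', In x X -> In x' X -> f x = f x' -> x = x') /\
  (forall x x', In x X -> In x' X -> (E x x' <-> E (f x) (f x'))).

Definition automorphism {T : Type} (E : T -> T -> Prop) (g : T -> T) : Prop :=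
  FinFun.Bijective g /\ forall x x', E x x' <-> E (g x) (g x').

Definition ultrahomogeneous {T : Type} (E : T -> T -> Prop) : Prop :=
  forall X Y f, sub_isomorphism E X Y f ->
    exists g, automorphism E g /\ forall x, In x X -> g x = f x.

Definition weakly_ultrahomogeneous {T : Type} (E : T -> T -> Prop) : Prop :=
  exists a : list T,
  forall X Y f, incl a X -> incl a Y -> sub_isomorphism E X Y f ->
    (forall x, In x a -> f x = x) ->
    exists g, automorphism E g /\ forall x, In x X -> g x = f x.

Definition eqv (e x y : nat) : Prop := phi e ⟨x, y⟩ 1.

(** Every number is a pair, so the first conjunct says that phi_e is total and
    is the characteristic function of [eqv e]. *)
Definition EQ (e : nat) : Prop :=
  (forall x y, phi e ⟨x, y⟩ 0 \/ phi e ⟨x, y⟩ 1) /\ Equivalence (eqv e).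

Definition UHQ (e : nat) : Prop := EQ e /\ ultrahomogeneous (eqv e).

Definition WUQ (e : nat) : Prop := EQ e /\ weakly_ultrahomogeneous (eqv e).

(* Main.v *)
Require Import Defs.
From Stdlib Require Import Arith Lia List RelationClasses Cantor FinFun ClassicalEpsilon.
Import ListNotations.

(** An equivalence structure is ultrahomogeneous if and only if all its classes
    have the same size, and weakly ultrahomogeneous if and only if all but
    finitely many do.  Enlarging the set of fixed elements makes homogeneity
    weaker, so initial segments suffice as such sets, and one notion covers both
    properties: the classes off [b], those without an element below [b], have
    equal size.  Ultrahomogeneity is the case [b = 0], weak
    ultrahomogeneity asks for some [b].  If classes off [b] are equal in size,
    a finite partial automorphism that fixes all numbers below [b] extends to any further
    point, and a back-and-forth construction makes it total
    ([homogeneous_of_equal_classes]); conversely the exchange of one point for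
    another is a partial automorphism that fixes these numbers, and an extension of
    it compares their classes ([equal_classes_of_homogeneous]).

    Upper bounds.  The graph of the universal function is the least fixed point
    of a $\Sigma^0_1$ operator, hence is $\Sigma^0_1$, since a derivation is a
    finite object ([sd_phi]).  That one class embeds in another can be tested
    on finite parts: for every finite part of the first class there is an
    embedding of it in the second.  Hence equality of sizes off [b] is
    $\Pi^0_2$ in the index and [b], as is the property of being an index of an
    equivalence structure ([Pi2_homogeneity_index]); the quantifier over [b]
    makes weak ultrahomogeneity $\Sigma^0_3$.

    Hardness.  A single construction serves both parts ([homogeneity_hard]).
    A $\Pi^0_2$ set [P] is of the form: infinitely many [t] satisfy [D] at [v],
    with [D] computable ([Pi2_infinite]).  Given [x], the structure has two
    classes for each [w]: one that is always infinite and one that is infinite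
    if and only if [P ⟨x, w'⟩] for some [w' <= w].  If [w0] is the least number
    with [P ⟨x, w0⟩], then exactly the first [w0] columns have a finite class;
    if there is none, infinitely many classes are finite and infinitely many
    are infinite.  So the structure is ultrahomogeneous if and only if
    [P ⟨x, 0⟩], and weakly so if and only if [P ⟨x, w⟩] for some [w]. *)

(** * Computable functions *)

Definition π1 (n : nat) : nat := fst (Cantor.of_nat n).
Definition π2 (n : nat) : nat := snd (Cantor.of_nat n).

Lemma π1_pair x y : π1 ⟨x, y⟩ = x.
Proof. unfold π1. now rewrite Cantor.cancel_of_to. Qed.

Lemma π2_pair x y : π2 ⟨x, y⟩ = y.
Proof. unfold π2. now rewrite Cantor.cancel_of_to. Qed.

Lemma pair_π v : ⟨π1 v, π2 v⟩ = v.
Proof. unfold π1, π2. rewrite <- surjective_pairing. apply Cantor.cancel_to_of. Qed.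

Lemma pair_inj a b c d : ⟨a, b⟩ = ⟨c, d⟩ -> a = c /\ b = d.
Proof. intros H. apply Cantor.to_nat_inj in H. now injection H. Qed.

Lemma pair_le_l x y : x <= ⟨x, y⟩.
Proof. pose proof (Cantor.to_nat_non_decreasing x y). lia. Qed.

Lemma pair_le_r x y : y <= ⟨x, y⟩.
Proof. pose proof (Cantor.to_nat_non_decreasing x y). lia. Qed.

Opaque Cantor.to_nat Cantor.of_nat.

Lemma computable_ext f g : (forall x, f x = g x) -> computable f -> computable g.
Proof. intros H [e He]. exists e. intros x. now rewrite <- H. Qed.

Lemma computable_comp f g :
  computable f -> computable g -> computable (fun v => f (g v)).
Proof. intros [a Ha] [b Hb]. exists ⟨5, ⟨a, b⟩⟩. intros x. now apply phi_comp with (g x). Qed.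

Lemma computable_π1 f : computable f -> computable (fun v => π1 (f v)).
Proof.
  apply (computable_comp π1). exists ⟨2, 0⟩. intros x.
  rewrite <- (pair_π x) at 1. constructor.
Qed.

Lemma computable_π2 f : computable f -> computable (fun v => π2 (f v)).
Proof.
  apply (computable_comp π2). exists ⟨3, 0⟩. intros x.
  rewrite <- (pair_π x) at 1. constructor.
Qed.

Lemma computable_pair f g :
  computable f -> computable g -> computable (fun v => ⟨f v, g v⟩).
Proof. intros [a Ha] [b Hb]. exists ⟨4, ⟨a, b⟩⟩. intros x. now constructor. Qed.

Lemma phi_id x : phi ⟨4, ⟨⟨2, 0⟩, ⟨3, 0⟩⟩⟩ x x.
Proof.
  rewrite <- (pair_π x). constructor; constructor.
Qed.

Lemma computable_id : computable (fun v => v).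
Proof. eexists. apply phi_id. Qed.

Lemma computable_S f : computable f -> computable (fun v => S (f v)).
Proof. apply (computable_comp S). exists ⟨1, 0⟩. constructor. Qed.

Lemma computable_const n : computable (fun _ => n).
Proof.
  induction n as [|n IH].
  - exists ⟨0, 0⟩. constructor.
  - now apply computable_S.
Qed.

Lemma computable_rec a (s : nat -> nat -> nat -> nat) n :
  computable a -> computable (fun w => s (π1 w) (π1 (π2 w)) (π2 (π2 w))) ->
  computable n ->
  computable (fun v => nat_rect (fun _ => nat) (a v) (s v) (n v)).
Proof.
  intros [ea Ha] [es Hs] Hn.
  assert (Hr : computable
    (fun w => nat_rect (fun _ => nat) (a (π1 w)) (s (π1 w)) (π2 w))).
  { exists ⟨6, ⟨ea, es⟩⟩. intros w. rewrite <- (pair_π w) at 1.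
    induction (π2 w) as [|k IH]; simpl.
    - now constructor.
    - econstructor; [exact IH|].
      set (u := nat_rect _ _ _ _).
      specialize (Hs ⟨π1 w, ⟨k, u⟩⟩). now rewrite !π1_pair, !π2_pair, π1_pair in Hs. }
  pose proof (computable_comp _ _ Hr (computable_pair _ _ computable_id Hn)) as H.
  revert H. apply computable_ext. intros v. now rewrite π1_pair, π2_pair.
Qed.

Ltac computability :=
  repeat (cbv beta; first
    [ assumption | apply computable_const | apply computable_id
    | apply computable_π1 | apply computable_π2 | apply computable_pair
    | apply computable_S ]).

Lemma computable_add f g :
  computable f -> computable g -> computable (fun v => f v + g v).
Proof.
  intros Hf Hg.
  apply computable_ext with (fun v => nat_rect (fun _ => nat) (f v) (fun _ r => S r) (g v)).
  - intros v. induction (g v); simpl; lia.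
  - apply (computable_rec f (fun _ _ r => S r) g); computability.
Qed.

Lemma computable_pred f : computable f -> computable (fun v => pred (f v)).
Proof.
  intros Hf.
  apply computable_ext with (fun v => nat_rect (fun _ => nat) 0 (fun k _ => k) (f v)).
  - intros v. now destruct (f v).
  - apply (computable_rec (fun _ => 0) (fun _ k _ => k) f); computability.
Qed.

Lemma computable_sub f g :
  computable f -> computable g -> computable (fun v => f v - g v).
Proof.
  intros Hf Hg.
  apply computable_ext with (fun v => nat_rect (fun _ => nat) (f v) (fun _ r => pred r) (g v)).
  - intros v. induction (g v); simpl; lia.
  - apply (computable_rec f (fun _ _ r => pred r) g); computability.
    apply computable_pred; computability.
Qed.

Lemma computable_mul f g :
  computable f -> computable g -> computable (fun v => f v * g v).
Proof.
  intros Hf Hg.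
  apply computable_ext with (fun v => nat_rect (fun _ => nat) 0 (fun _ r => f v + r) (g v)).
  - intros v. induction (g v); simpl; lia.
  - apply (computable_rec (fun _ => 0) (fun v _ r => f v + r) g); computability.
    apply computable_add; [apply computable_comp|]; computability.
Qed.

(** The s-m-n theorem.  The index [f x] composes an index of [h] with the
    pairing of the constant function [x] and the identity, and an index of the
    constant [x] is obtained by recursion on [x]. *)
Lemma smn h :
  computable h ->
  exists f, computable f /\ forall x w, phi (f x) w (h ⟨x, w⟩).
Proof.
  intros [e He].
  set (c := fun x => nat_rect (fun _ => nat) ⟨0, 0⟩ (fun _ r => ⟨5, ⟨⟨1, 0⟩, r⟩⟩) x).
  exists (fun x => ⟨5, ⟨e, ⟨4, ⟨c x, ⟨4, ⟨⟨2, 0⟩, ⟨3, 0⟩⟩⟩⟩⟩⟩⟩). split.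
  - computability.
    apply (computable_rec (fun _ => ⟨0, 0⟩) (fun _ _ r => ⟨5, ⟨⟨1, 0⟩, r⟩⟩)
             (fun x => x)); computability.
  - intros x w. apply phi_comp with ⟨x, w⟩; [|apply He].
    constructor; [|apply phi_id].
    induction x as [|x IH]; simpl; econstructor; [exact IH | constructor].
Qed.

(** Iterated pairing codes finite sequences without recording a length: the
    entries past the end are zero. *)
Definition entry (t j : nat) : nat := π1 (Nat.iter j π2 t).

Fixpoint code (l : list nat) : nat :=
  match l with [] => 0 | q :: l => ⟨q, code l⟩ end.

Lemma entry_code l j : j < length l -> entry (code l) j = nth j l 0.
Proof.
  revert j. induction l as [|q l IH]; simpl; intros j Hj; [lia|].
  destruct j as [|j]; unfold entry.
  - apply π1_pair.
  - rewrite Nat.iter_succ_r, π2_pair. apply IH. lia.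
Qed.

Lemma entry_realizes f N : exists t, forall u, u < N -> entry t u = f u.
Proof.
  exists (code (map f (seq 0 N))). intros u Hu.
  rewrite entry_code by (now rewrite length_map, length_seq).
  rewrite nth_indep with (d' := f 0) by (now rewrite length_map, length_seq).
  now rewrite map_nth, seq_nth.
Qed.

Lemma computable_entry f g :
  computable f -> computable g -> computable (fun v => entry (f v) (g v)).
Proof.
  intros Hf Hg. apply computable_π1.
  apply (computable_rec f (fun _ _ r => π2 r) g); computability.
Qed.

(* Unfolded, an entry would be taken for a first projection in the syntactic
   search for computability proofs. *)
Opaque entry.

Ltac computability ::=
  repeat (cbv beta; first
    [ assumption | apply computable_const | apply computable_id
    | apply computable_π1 | apply computable_π2 | apply computable_pair
    | apply computable_S | apply computable_add | apply computable_sub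
    | apply computable_mul | apply computable_entry ]).

(** * Computable sets *)

Lemma set_ext A B : (forall x, A x <-> B x) -> computable_set A -> computable_set B.
Proof.
  intros H (f & Hf & HA). exists f. split; [assumption|].
  intros x. specialize (H x). destruct (HA x) as [[]|[]]; tauto.
Qed.

Lemma set_dec A : computable_set A -> forall x, A x \/ ~ A x.
Proof. intros (f & _ & HA) x. destruct (HA x); tauto. Qed.

Lemma set_subst A f : computable_set A -> computable f -> computable_set (fun v => A (f v)).
Proof.
  intros (g & Hg & HA) Hf. exists (fun v => g (f v)). split.
  - now apply computable_comp.
  - intros x. apply HA.
Qed.

Lemma set_not A : computable_set A -> computable_set (fun v => ~ A v).
Proof.
  intros (g & Hg & HA). exists (fun v => 1 - g v). split; [computability|].
  intros x. destruct (HA x) as [[H ->]|[H ->]]; simpl; tauto.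
Qed.

Lemma set_and A B :
  computable_set A -> computable_set B -> computable_set (fun v => A v /\ B v).
Proof.
  intros (f & Hf & HA) (g & Hg & HB). exists (fun v => f v * g v). split; [computability|].
  intros x. destruct (HA x) as [[H ->]|[H ->]], (HB x) as [[H' ->]|[H' ->]]; simpl; tauto.
Qed.

Lemma set_or A B :
  computable_set A -> computable_set B -> computable_set (fun v => A v \/ B v).
Proof.
  intros HA HB. apply set_ext with (fun v => ~ (~ A v /\ ~ B v)).
  - intros x. destruct (set_dec A HA x), (set_dec B HB x); tauto.
  - apply set_not, set_and; now apply set_not.
Qed.

Lemma set_iff A B :
  computable_set A -> computable_set B -> computable_set (fun v => A v <-> B v).
Proof.
  intros HA HB. apply set_ext with (fun v => (A v /\ B v) \/ (~ A v /\ ~ B v)).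
  - intros x. destruct (set_dec A HA x), (set_dec B HB x); tauto.
  - apply set_or; apply set_and; auto using set_not.
Qed.

Lemma set_zero f : computable f -> computable_set (fun v => f v = 0).
Proof.
  intros Hf. exists (fun v => 1 - f v). split; [computability|].
  intros x. lia.
Qed.

Lemma set_eq f g : computable f -> computable g -> computable_set (fun v => f v = g v).
Proof.
  intros Hf Hg. apply set_ext with (fun v => (f v - g v) + (g v - f v) = 0).
  - intros x. lia.
  - apply set_zero; computability.
Qed.

Lemma set_le f g : computable f -> computable g -> computable_set (fun v => f v <= g v).
Proof.
  intros Hf Hg. apply set_ext with (fun v => f v - g v = 0).
  - intros x. lia.
  - apply set_zero; computability.
Qed.

Lemma set_ball b (P : nat -> nat -> Prop) :
  computable b -> computable_set (fun w => P (π1 w) (π2 w)) ->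
  computable_set (fun v => forall k, k < b v -> P v k).
Proof.
  intros Hb (f & Hf & HP).
  exists (fun v => nat_rect (fun _ => nat) 1 (fun k r => r * f ⟨v, k⟩) (b v)). split.
  - apply (computable_rec (fun _ => 1) (fun v k r => r * f ⟨v, k⟩) b); computability.
    apply computable_comp; computability.
  - intros v. induction (b v) as [|n IH]; simpl.
    + left. split; [intros; lia | reflexivity].
    + specialize (HP ⟨v, n⟩). rewrite π1_pair, π2_pair in HP.
      destruct IH as [[H ->]|[H ->]].
      * destruct HP as [[H' ->]|[H' ->]].
        -- left. split; [|reflexivity]. intros k Hk.
           destruct (Nat.eq_dec k n) as [->|]; [assumption | apply H; lia].
        -- right. split; [|reflexivity]. intros K. apply H', K. lia.
      * right. split; [|reflexivity]. intros K. apply H. intros k Hk. apply K. lia.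
Qed.

Lemma set_bex b (P : nat -> nat -> Prop) :
  computable b -> computable_set (fun w => P (π1 w) (π2 w)) ->
  computable_set (fun v => exists k, k < b v /\ P v k).
Proof.
  intros Hb HP.
  pose proof (set_ball b (fun v k => ~ P v k) Hb (set_not _ HP)) as H.
  apply set_ext with (fun v => ~ (forall k, k < b v -> ~ P v k)); [|now apply set_not].
  intros v. split.
  - intros K. apply NNPP. intros N. apply K. intros k Hk Hp. apply N. now exists k.
  - intros (k & Hk & Hp) K. now apply (K k).
Qed.

Ltac decidability :=
  repeat (cbv beta; first
    [ assumption
    | apply set_not | apply set_iff | apply set_and | apply set_or
    | apply set_le | apply set_eq | apply set_ball | apply set_bex
    | match goal with H : computable_set ?B |- _ => apply (set_subst B _ H) end
    | progress computability ]).

(** * Semidecidable sets *)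

Lemma collection (R : nat -> nat -> Prop) n :
  (forall k m m', m <= m' -> R k m -> R k m') ->
  (forall k, k < n -> exists m, R k m) ->
  exists m, forall k, k < n -> R k m.
Proof.
  intros Hmono. induction n as [|n IH]; intros H.
  - exists 0. intros; lia.
  - destruct IH as [m Hm]; [intros; apply H; lia|].
    destruct (H n) as [m' Hm']; [lia|].
    exists (m + m'). intros k Hk. destruct (Nat.eq_dec k n) as [->|].
    + apply Hmono with m'; [lia | assumption].
    + apply Hmono with m; [lia | apply Hm; lia].
Qed.

Notation semidecidable := (Sigma0 1).

Lemma sd_intro A D :
  computable_set D -> (forall v, A v <-> exists s, D ⟨v, s⟩) -> semidecidable A.
Proof. intros HD H. exists D. now split. Qed.

Lemma sd_dec A : computable_set A -> semidecidable A.
Proof.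
  intros HA. apply sd_intro with (fun w => A (π1 w)); [decidability|].
  intros v. split.
  - intros H. exists 0. now rewrite π1_pair.
  - intros [s H]. now rewrite π1_pair in H.
Qed.

Lemma sd_ext A B : (forall x, A x <-> B x) -> semidecidable A -> semidecidable B.
Proof.
  intros H (D & HD & HA). apply sd_intro with D; [assumption|].
  intros v. rewrite <- H. apply HA.
Qed.

Lemma sd_subst A f :
  semidecidable A -> computable f -> semidecidable (fun v => A (f v)).
Proof.
  intros (D & HD & HA) Hf. cbn in HD. apply sd_intro with (fun w => D ⟨f (π1 w), π2 w⟩).
  - apply (set_subst D (fun w => ⟨f (π1 w), π2 w⟩) HD).
    apply computable_pair; [apply computable_comp|]; computability.
  - intros v. rewrite HA. split; intros [s H]; exists s.
    + now rewrite π1_pair, π2_pair.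
    + now rewrite π1_pair, π2_pair in H.
Qed.

Lemma sd_and A B :
  semidecidable A -> semidecidable B -> semidecidable (fun v => A v /\ B v).
Proof.
  intros (D & HD & HA) (D' & HD' & HB). cbn in HD, HD'.
  apply sd_intro with (fun w => D ⟨π1 w, π1 (π2 w)⟩ /\ D' ⟨π1 w, π2 (π2 w)⟩);
    [decidability|].
  intros v. rewrite HA, HB. split.
  - intros [[s H] [s' H']]. exists ⟨s, s'⟩. now rewrite π2_pair, !π1_pair, π2_pair.
  - intros [s H]. rewrite !π1_pair, !π2_pair in H. destruct H; split; eauto.
Qed.

Lemma sd_or A B :
  semidecidable A -> semidecidable B -> semidecidable (fun v => A v \/ B v).
Proof.
  intros (D & HD & HA) (D' & HD' & HB). cbn in HD, HD'.
  apply sd_intro with (fun w => D w \/ D' w); [decidability|].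
  intros v. rewrite HA, HB. split.
  - intros [[s H] | [s H]]; exists s; tauto.
  - intros [s [H|H]]; eauto.
Qed.

Lemma sd_ex (P : nat -> nat -> Prop) :
  semidecidable (fun w => P (π1 w) (π2 w)) -> semidecidable (fun v => exists u, P v u).
Proof.
  intros (D & HD & HP). cbn in HD.
  apply sd_intro with (fun w => D ⟨⟨π1 w, π1 (π2 w)⟩, π2 (π2 w)⟩); [decidability|].
  intros v. split.
  - intros [u Hu]. specialize (HP ⟨v, u⟩). rewrite π1_pair, π2_pair in HP.
    apply HP in Hu as [s Hs]. exists ⟨u, s⟩. now rewrite !π2_pair, !π1_pair.
  - intros [s Hs]. rewrite !π2_pair, !π1_pair in Hs.
    exists (π1 s). specialize (HP ⟨v, π1 s⟩). rewrite π1_pair, π2_pair in HP.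
    apply HP. eauto.
Qed.

(** A common bound for the finitely many witnesses moves the unbounded
    quantifier to the front. *)
Lemma sd_ball b (P : nat -> nat -> Prop) :
  computable b -> semidecidable (fun w => P (π1 w) (π2 w)) ->
  semidecidable (fun v => forall k, k < b v -> P v k).
Proof.
  intros Hb (D & HD & HP). cbn in HD.
  apply sd_intro with
    (fun w => forall k, k < b (π1 w) -> exists s, s < π2 w /\ D ⟨⟨π1 w, k⟩, s⟩).
  { decidability. apply computable_comp; computability. }
  assert (HP' : forall v k, P v k <-> exists s, D ⟨⟨v, k⟩, s⟩).
  { intros v k. specialize (HP ⟨v, k⟩). now rewrite π1_pair, π2_pair in HP. }
  intros v. split.
  - intros H.
    destruct (collection (fun k t => exists s, s < t /\ D ⟨⟨v, k⟩, s⟩) (b v)) as [t Ht].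
    + intros k m m' Hm (s & Hs & K). exists s. split; [lia | assumption].
    + intros k Hk. apply H, HP' in Hk as [s Hs]. exists (S s), s. split; [lia | assumption].
    + exists t. now rewrite π1_pair, π2_pair.
  - intros [t Ht] k Hk. rewrite π1_pair, π2_pair in Ht.
    destruct (Ht k Hk) as (s & _ & Hs). apply HP'. eauto.
Qed.

Ltac semidecidability :=
  repeat (cbv beta; first
    [ assumption | apply sd_and | apply sd_or | apply sd_ex
    | apply sd_ball; [solve [computability]|]
    | solve [apply sd_dec; decidability] ]).

(** * The graph of the universal function *)

(** One application of a rule of [phi], with premises taken from [H]: [phi] is
    the least fixed point of this monotone operator. *)
Definition rule (H : nat -> nat -> nat -> Prop) (e x y : nat) : Prop :=
  (exists r, e = ⟨0, r⟩ /\ y = 0) \/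
  (exists r, e = ⟨1, r⟩ /\ y = S x) \/
  (exists r z, e = ⟨2, r⟩ /\ x = ⟨y, z⟩) \/
  (exists r z, e = ⟨3, r⟩ /\ x = ⟨z, y⟩) \/
  (exists a b u v, e = ⟨4, ⟨a, b⟩⟩ /\ y = ⟨u, v⟩ /\ H a x u /\ H b x v) \/
  (exists a b u, e = ⟨5, ⟨a, b⟩⟩ /\ H b x u /\ H a u y) \/
  (exists a b z, e = ⟨6, ⟨a, b⟩⟩ /\ x = ⟨z, 0⟩ /\ H a z y) \/
  (exists a b z n u, e = ⟨6, ⟨a, b⟩⟩ /\ x = ⟨z, S n⟩ /\
     H ⟨6, ⟨a, b⟩⟩ ⟨z, n⟩ u /\ H b ⟨z, ⟨n, u⟩⟩ y) \/
  (exists a, e = ⟨7, a⟩ /\ H a ⟨x, y⟩ 0 /\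
     forall k, k < y -> exists w, H a ⟨x, k⟩ (S w)).

Ltac rule_cases H :=
  destruct H as
    [(? & ? & ?) | [(? & ? & ?) | [(? & ? & ? & ?) | [(? & ? & ? & ?) |
    [(? & ? & ? & ? & ? & ? & ? & ?) | [(? & ? & ? & ? & ? & ?) |
    [(? & ? & ? & ? & ? & ?) | [(? & ? & ? & ? & ? & ? & ? & ? & ?) |
    (? & ? & ? & ?)]]]]]]]].

Lemma rule_mono (H K : nat -> nat -> nat -> Prop) :
  (forall e x y, H e x y -> K e x y) -> forall e x y, rule H e x y -> rule K e x y.
Proof.
  intros HK e x y R. unfold rule in *. rule_cases R.
  - left; eauto.
  - right; left; eauto.
  - do 2 right; left; eauto.
  - do 3 right; left; eauto.
  - do 4 right; left; eauto 10.
  - do 5 right; left; eauto 10.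
  - do 6 right; left; eauto 10.
  - do 7 right; left; eauto 12.
  - do 8 right. eexists. repeat split; eauto.
    intros k Hk.
    match goal with W : forall k, _ -> exists w, H _ _ _ |- _ => destruct (W k Hk) end; eauto.
Qed.

Lemma rule_phi e x y : rule phi e x y -> phi e x y.
Proof.
  intros R. unfold rule in R. rule_cases R; subst; try (econstructor; eassumption).
  (* Minimization wants a function choosing the values. *)
  match goal with W : forall k, _ -> exists w, phi ?a _ _ |- phi ⟨_, ?a'⟩ _ _ =>
    apply phi_mu with (w := fun k => epsilon (inhabits 0) (fun w => phi a' ⟨x, k⟩ (S w)));
    [intros k Hk; exact (epsilon_spec _ (fun w => phi a' ⟨x, k⟩ (S w)) (W k Hk)) | assumption]
  end.
Qed.

Lemma phi_least (H : nat -> nat -> nat -> Prop) :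
  (forall e x y, rule H e x y -> H e x y) -> forall e x y, phi e x y -> H e x y.
Proof.
  intros HH e x y P. induction P; apply HH; unfold rule.
  - left; eauto.
  - right; left; eauto.
  - do 2 right; left; eauto.
  - do 3 right; left; eauto.
  - do 4 right; left. exists a, b, u, v. auto.
  - do 5 right; left. exists a, b, u. auto.
  - do 6 right; left. exists a, b, x. auto.
  - do 7 right; left. exists a, b, x, n, u. auto.
  - do 8 right. exists a. repeat split; eauto.
Qed.

Lemma phi_rule e x y : phi e x y -> rule phi e x y.
Proof.
  revert e x y. apply phi_least. apply rule_mono. exact rule_phi.
Qed.

Lemma phi_functional e x y : phi e x y -> forall y', phi e x y' -> y = y'.
Proof.
  revert e x y. apply (phi_least (fun e x y => forall y', phi e x y' -> y = y')).
  intros e x y R y' P. apply phi_rule in P. unfold rule in R, P.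
  rule_cases R; rule_cases P; subst;
    repeat match goal with
    | H : ⟨_, _⟩ = ⟨_, _⟩ |- _ => apply pair_inj in H as [? ?]
    | H : S _ = S _ |- _ => injection H as ?
    end; try discriminate; subst; auto.
  - f_equal; f_equal; auto.
  - match goal with IH : forall y', phi ?b x y' -> ?u = y', P : phi ?b x _ |- _ =>
      apply IH in P; subst end. auto.
  - match goal with IH : forall y', phi ⟨6, _⟩ _ y' -> ?u = y', P : phi ⟨6, _⟩ _ _ |- _ =>
      apply IH in P; subst end. auto.
  - (* Of two different candidates for the least zero, the smaller one would
       be assigned both a zero and a positive value. *)
    match goal with
    | V : forall k, k < y -> _, Z : forall v, phi _ _ v -> 0 = v,
      V' : forall k, k < y' -> _, Z' : phi _ _ 0 |- _ =>
      destruct (Nat.lt_trichotomy y y') as [L|[L|L]];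
      [ destruct (V' y L) as [w Hw]; apply Z in Hw; discriminate
      | exact L
      | destruct (V y' L) as [w Hw]; apply Hw in Z'; discriminate ]
    end.
Qed.

(** Derivations are lists instead of trees: subderivations are combined by
    concatenation, and a list is readily coded by a number. *)
Fixpoint derivation (l : list nat) : Prop :=
  match l with
  | [] => True
  | q :: l =>
      rule (fun e x y => In ⟨e, ⟨x, y⟩⟩ l) (π1 q) (π1 (π2 q)) (π2 (π2 q)) /\ derivation l
  end.

Lemma derivation_app l l' : derivation l -> derivation l' -> derivation (l ++ l').
Proof.
  induction l as [|q l IH]; simpl; [auto|].
  intros [R D] D'. split; [|auto].
  revert R. apply rule_mono. intros. apply in_or_app. auto.
Qed.

Definition derivable (e x y : nat) : Prop :=
  exists l, derivation l /\ In ⟨e, ⟨x, y⟩⟩ l.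

Lemma derivable_of_list l e x y :
  derivation l -> rule (fun e x y => In ⟨e, ⟨x, y⟩⟩ l) e x y -> derivable e x y.
Proof.
  intros D R. exists (⟨e, ⟨x, y⟩⟩ :: l). split; [|now left].
  cbn [derivation]. now rewrite !π2_pair, !π1_pair.
Qed.

(** A rule uses finitely many premises, so derivations of all of them can be
    concatenated; minimization is the only rule with an unbounded number. *)
Lemma derivable_rule e x y : rule derivable e x y -> derivable e x y.
Proof.
  intros R. unfold rule in R. rule_cases R; subst;
    repeat match goal with H : derivable _ _ _ |- _ => destruct H as (? & ? & ?) end.
  - apply (derivable_of_list []); [exact I|]. left. eauto.
  - apply (derivable_of_list []); [exact I|]. right; left. eauto.
  - apply (derivable_of_list []); [exact I|]. do 2 right; left. eauto.
  - apply (derivable_of_list []); [exact I|]. do 3 right; left. eauto.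
  - match goal with D : derivation ?l, D' : derivation ?l' |- _ =>
      apply (derivable_of_list (l ++ l')); [now apply derivation_app|] end.
    do 4 right; left. do 4 eexists. repeat split; apply in_or_app; eauto.
  - match goal with D : derivation ?l, D' : derivation ?l' |- _ =>
      apply (derivable_of_list (l ++ l')); [now apply derivation_app|] end.
    do 5 right; left. do 3 eexists. repeat split; apply in_or_app; eauto.
  - eapply derivable_of_list; [eassumption|].
    do 6 right; left. do 3 eexists. repeat split; eassumption.
  - match goal with D : derivation ?l, D' : derivation ?l' |- _ =>
      apply (derivable_of_list (l ++ l')); [now apply derivation_app|] end.
    do 7 right; left. do 5 eexists. repeat split; apply in_or_app; eauto.
  - match goal with
    | W : forall k, k < y -> exists w, derivable ?a _ _, D : derivation ?l |- _ =>
      assert (exists l', derivation l' /\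
        forall k, k < y -> exists w, In ⟨a, ⟨⟨x, k⟩, S w⟩⟩ l') as (l' & D' & W');
      [ revert W; clear; induction y as [|n IH]; intros Hw | ]
    end.
    + exists []. split; [exact I | intros; lia].
    + destruct IH as (l & D & L); [intros; apply Hw; lia|].
      destruct (Hw n) as (w & l' & D' & L'); [lia|].
      exists (l ++ l'). split; [now apply derivation_app|]. intros k Hk.
      destruct (Nat.eq_dec k n) as [->|].
      * exists w. apply in_or_app. auto.
      * destruct (L k) as [w' Hw']; [lia|]. exists w'. apply in_or_app. auto.
    + match goal with D : derivation ?l, _ : In _ ?l |- _ =>
        apply (derivable_of_list (l ++ l')); [now apply derivation_app|] end.
      do 8 right. eexists. split; [reflexivity|]. split; [apply in_or_app; eauto|].
      intros k Hk. destruct (W' k Hk) as [w Hw]. exists w. apply in_or_app. auto.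
Qed.

(** Only bounded quantifiers over entries of [t] are added to those of [rule],
    which keeps the condition $\Sigma^0_1$; [n] is the length of the list. *)
Definition coded_derivation (n t : nat) : Prop :=
  forall j, j < n ->
    rule (fun e x y => exists i, j < i /\ i < n /\ entry t i = ⟨e, ⟨x, y⟩⟩)
      (π1 (entry t j)) (π1 (π2 (entry t j))) (π2 (π2 (entry t j))).

Lemma derivation_nth l j :
  derivation l -> j < length l ->
  rule (fun e x y => exists i, j < i /\ i < length l /\ nth i l 0 = ⟨e, ⟨x, y⟩⟩)
    (π1 (nth j l 0)) (π1 (π2 (nth j l 0))) (π2 (π2 (nth j l 0))).
Proof.
  revert j. induction l as [|q l IH]; simpl; intros j HD Hj; [lia|]. destruct HD as [R D].
  destruct j as [|j].
  - revert R. apply rule_mono. intros e x y H.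
    apply (In_nth _ _ 0) in H as (i & Hi & H). exists (S i). repeat split; [lia..|exact H].
  - specialize (IH j D ltac:(lia)). revert IH. apply rule_mono.
    intros e x y (i & H1 & H2 & H). exists (S i). repeat split; [lia..|exact H].
Qed.

Lemma phi_iff_coded_derivation e x y :
  phi e x y <->
  exists n t, coded_derivation n t /\ exists j, j < n /\ entry t j = ⟨e, ⟨x, y⟩⟩.
Proof.
  split.
  - intros P. apply (phi_least derivable derivable_rule) in P as (l & D & H).
    exists (length l), (code l). split.
    + intros j Hj. rewrite entry_code by assumption.
      generalize (derivation_nth l j D Hj). apply rule_mono.
      intros e' x' y' (i & H1 & H2 & H'). exists i. now rewrite entry_code.
    + apply (In_nth _ _ 0) in H as (j & Hj & H). exists j. now rewrite entry_code.
  - intros (n & t & D & j & Hj & H).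
    assert (sound : forall d j, n - j = d -> j < n ->
      phi (π1 (entry t j)) (π1 (π2 (entry t j))) (π2 (π2 (entry t j)))).
    { clear j Hj H. induction d as [d IH] using lt_wf_ind. intros j Hd Hj.
      apply rule_phi. generalize (D j Hj). apply rule_mono.
      intros e' x' y' (i & H1 & H2 & H). specialize (IH (n - i) ltac:(lia) i eq_refl H2).
      now rewrite H, !π2_pair, !π1_pair in IH. }
    specialize (sound _ j eq_refl Hj). now rewrite H, !π2_pair, !π1_pair in sound.
Qed.

Lemma sd_phi e x y :
  computable e -> computable x -> computable y ->
  semidecidable (fun v => phi (e v) (x v) (y v)).
Proof.
  intros He Hx Hy.
  assert (U : semidecidable (fun v => phi (π1 v) (π1 (π2 v)) (π2 (π2 v)))).
  { eapply sd_ext; [intros v; symmetry; apply phi_iff_coded_derivation|].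
    unfold coded_derivation, rule. semidecidability. }
  apply (sd_ext (fun v => phi (π1 ⟨e v, ⟨x v, y v⟩⟩) (π1 (π2 ⟨e v, ⟨x v, y v⟩⟩))
                            (π2 (π2 ⟨e v, ⟨x v, y v⟩⟩)))).
  - intros v. now rewrite !π2_pair, !π1_pair.
  - apply (sd_subst _ (fun v => ⟨e v, ⟨x v, y v⟩⟩) U). computability.
Qed.

(** * Homogeneity of equivalence relations *)

(** Stage [n] of a chain of good lists adds [n] to the arguments and to the
    values, so the union of the chain is the graph of a bijection. *)
Lemma back_and_forth (E : nat -> nat -> Prop) (Good : list (nat * nat) -> Prop) :
  (forall p, Good p -> forall x y x' y', In (x, y) p -> In (x', y') p ->
     (x = x' <-> y = y') /\ (E x x' <-> E y y')) ->
  (forall p x, Good p -> exists y, Good ((x, y) :: p)) ->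
  (forall p y, Good p -> exists x, Good ((x, y) :: p)) ->
  forall p, Good p ->
  exists g, automorphism E g /\ forall x y, In (x, y) p -> g x = y.
Proof.
  intros Hiso forth back p0 H0.
  assert (step : forall n p, exists p', Good p -> Good p' /\ incl p p' /\
            (exists y, In (n, y) p') /\ (exists x, In (x, n) p')).
  { intros n p. destruct (classic (Good p)) as [Hp|Hp]; [|exists p; tauto].
    destruct (forth p n Hp) as [y Hy], (back _ n Hy) as [x Hx].
    exists ((x, n) :: (n, y) :: p). intros _. split; [assumption|]. split.
    - intros q Hq. now do 2 right.
    - split; [exists y | exists x]; simpl; auto. }
  set (next := fun n p => proj1_sig (constructive_indefinite_description _ (step n p))).
  assert (Hnext : forall n p, Good p -> Good (next n p) /\ incl p (next n p) /\
            (exists y, In (n, y) (next n p)) /\ (exists x, In (x, n) (next n p))).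
  { intros n p. exact (proj2_sig (constructive_indefinite_description _ (step n p))). }
  set (chain := nat_rect (fun _ => list (nat * nat)) p0 next).
  assert (Hchain : forall n, Good (chain n)).
  { induction n; [exact H0 | now apply Hnext]. }
  assert (Hincl : forall m n, m <= n -> incl (chain m) (chain n)).
  { intros m n Hmn. induction Hmn as [|n Hmn IH]; [apply incl_refl|].
    apply incl_tran with (chain n); [assumption | now apply Hnext]. }
  set (G := fun x y => exists n, In (x, y) (chain n)).
  assert (HG : forall x y x' y', G x y -> G x' y' ->
            (x = x' <-> y = y') /\ (E x x' <-> E y y')).
  { intros x y x' y' [n Hn] [m Hm]. apply (Hiso (chain (max n m))); [apply Hchain|..].
    - apply (Hincl n); [lia | assumption].
    - apply (Hincl m); [lia | assumption]. }
  assert (Htot : forall x, exists y, G x y).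
  { intros x. destruct (Hnext x (chain x) (Hchain x)) as (_ & _ & [y Hy] & _).
    exists y, (S x). exact Hy. }
  assert (Hsurj : forall y, exists x, G x y).
  { intros y. destruct (Hnext y (chain y) (Hchain y)) as (_ & _ & _ & [x Hx]).
    exists x, (S y). exact Hx. }
  set (g := fun x => proj1_sig (constructive_indefinite_description _ (Htot x))).
  assert (Hg : forall x, G x (g x)).
  { intros x. exact (proj2_sig (constructive_indefinite_description _ (Htot x))). }
  set (h := fun y => proj1_sig (constructive_indefinite_description _ (Hsurj y))).
  assert (Hh : forall y, G (h y) y).
  { intros y. exact (proj2_sig (constructive_indefinite_description _ (Hsurj y))). }
  exists g. split; [split|].
  - exists h. split; [intros x | intros y].
    + apply (HG (h (g x)) (g x) x (g x)); auto.
    + apply (HG (h y) (g (h y)) (h y) y); auto.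
  - intros x x'. apply (HG x (g x) x' (g x')); auto.
  - intros x y Hp. apply (HG x (g x) x y); [apply Hg | now exists 0 | reflexivity].
Qed.

(** The iterates of [x] under a map into a finite set that reflects [E] would
    be pairwise inequivalent: pulling an equivalence between two of them back
    along the map ends with an equivalence between [x] and an element of [D]. *)
Lemma no_reflecting_contraction (E : nat -> nat -> Prop) (D : nat -> Prop) l x h :
  (forall u, E u u) ->
  (forall u, D u -> In u l) ->
  (forall u, u = x \/ D u -> D (h u)) ->
  (forall u v, u = x \/ D u -> v = x \/ D v -> E (h u) (h v) -> E u v) ->
  exists d, D d /\ E x d.
Proof.
  intros Erefl Dl Dh Eh. apply NNPP. intros N.
  set (it := fun i => Nat.iter i h x).
  assert (itD : forall i, D (it (S i))).
  { induction i as [|i IH]; apply Dh; [now left | now right]. }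
  assert (itD' : forall i, it i = x \/ D (it i)).
  { intros [|i]; [now left | right; apply itD]. }
  assert (K : forall i k, ~ E (it i) (it (i + S k))).
  { induction i as [|i IH]; intros k HE.
    - apply N. exists (it (S k)). split; [apply itD | exact HE].
    - apply (IH k). now apply Eh. }
  assert (inj : Injective (fun i => it (S i))).
  { intros i j Hij. destruct (Nat.lt_trichotomy i j) as [L|[L|L]]; [|exact L|]; exfalso.
    - apply (K (S i) (j - S i)). replace (S i + S (j - S i)) with (S j) by lia.
      rewrite <- Hij. apply Erefl.
    - apply (K (S j) (i - S j)). replace (S j + S (i - S j)) with (S i) by lia.
      rewrite Hij. apply Erefl. }
  assert (ND : NoDup (map (fun i => it (S i)) (seq 0 (S (length l))))).
  { apply Injective_map_NoDup; [exact inj | apply seq_NoDup]. }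
  apply NoDup_incl_length with (l' := l) in ND.
  - rewrite length_map, length_seq in ND. lia.
  - intros u Hu. apply in_map_iff in Hu as (i & <- & _). apply Dl, itD.
Qed.

(** The class of [x] is at most as large as the class of [y], expressed on
    finite parts: only the values of [f] at arguments below [N] matter, and these can be
    coded by a number. *)
Definition class_le (E : nat -> nat -> Prop) (x y : nat) : Prop :=
  forall N, exists f, forall u, u < N -> E x u ->
    E y (f u) /\ forall u', u' < N -> E x u' -> f u' = f u -> u' = u.

Definition equal_classes_off (b : nat) (E : nat -> nat -> Prop) : Prop :=
  forall x y, (forall i, i < b -> ~ E i x) -> (forall i, i < b -> ~ E i y) ->
    class_le E x y.

Definition homogeneous_over {T : Type} (a : list T) (E : T -> T -> Prop) : Prop :=
  forall X Y f, incl a X -> incl a Y -> sub_isomorphism E X Y f ->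
    (forall x, In x a -> f x = x) ->
    exists g, automorphism E g /\ forall x, In x X -> g x = f x.

Lemma list_bound (l : list nat) : exists b, forall x, In x l -> x < b.
Proof.
  exists (S (list_max l)). intros x Hx.
  pose proof (proj1 (list_max_le l (list_max l)) (le_n _)) as H.
  rewrite Forall_forall in H. specialize (H x Hx). lia.
Qed.

(** Neither [x] nor [y] is related to a number below [b], so replacing [x] by
    [y] in the list of [x] and these numbers is an isomorphism; an automorphism
    that extends it embeds the class of [x] in that of [y]. *)
Lemma equal_classes_of_homogeneous E b :
  Equivalence E -> homogeneous_over (seq 0 b) E -> equal_classes_off b E.
Proof.
  intros HE H x y Hx Hy.
  assert (Ex : forall i, i < b -> ~ E x i) by (intros i Hi K; apply (Hx i Hi); now symmetry).
  assert (Ey : forall i, i < b -> ~ E y i) by (intros i Hi K; apply (Hy i Hi); now symmetry).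
  assert (Hxb : b <= x) by (apply Nat.nlt_ge; intros K; now apply (Hx x K)).
  assert (Hyb : b <= y) by (apply Nat.nlt_ge; intros K; now apply (Hy y K)).
  set (f := fun u => if Nat.eq_dec u x then y else u).
  assert (fx : f x = y) by (unfold f; now destruct Nat.eq_dec).
  assert (fi : forall i, i < b -> f i = i).
  { intros i Hi. unfold f. destruct Nat.eq_dec; [lia | reflexivity]. }
  destruct (H (x :: seq 0 b) (y :: seq 0 b) f) as (g & [[h [hg gh]] Hg] & gX).
  - apply incl_tl, incl_refl.
  - apply incl_tl, incl_refl.
  - assert (C : forall u, In u (x :: seq 0 b) -> u = x \/ u < b).
    { intros u [<-|Hu]; [now left | right; apply in_seq in Hu; lia]. }
    assert (I : forall i z, i < b -> In i (z :: seq 0 b)).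
    { intros i z Hi. right. apply in_seq. lia. }
    repeat split.
    + intros u Hu. apply C in Hu as [->|Hu].
      * rewrite fx. now left.
      * rewrite (fi u Hu). now apply I.
    + intros v [<-|Hv].
      * exists x. split; [now left | exact fx].
      * apply in_seq in Hv. exists v. split; [now right; apply in_seq | apply fi; lia].
    + intros u v Hu Hv. apply C in Hu as [->|Hu], Hv as [->|Hv];
        rewrite ?fx, ?fi by assumption; lia.
    + intros K. apply C in H0 as [->|Hu], H1 as [->|Hv];
        rewrite ?fx, ?fi in * by assumption; try reflexivity; try assumption.
      * now destruct (Ex _ Hv).
      * now destruct (Hx _ Hu).
    + intros K. apply C in H0 as [->|Hu], H1 as [->|Hv];
        rewrite ?fx, ?fi in * by assumption; try reflexivity; try assumption.
      * now destruct (Ey _ Hv).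
      * now destruct (Hy _ Hu).
  - intros i Hi. apply in_seq in Hi. apply fi. lia.
  - intros N. exists g. intros u _ Hu. split.
    + replace y with (g x) by (rewrite gX; [exact fx | now left]).
      exact (proj1 (Hg x u) Hu).
    + intros u' _ _ K. rewrite <- (hg u'), <- (hg u). now f_equal.
Qed.

(** Pairs instead of functions make the notion symmetric, so that prolonging to
    a given value is prolonging the swapped list to a given argument. *)
Definition partial_automorphism (E : nat -> nat -> Prop) (b : nat)
    (p : list (nat * nat)) : Prop :=
  (forall x y x' y', In (x, y) p -> In (x', y') p ->
     (x = x' <-> y = y') /\ (E x x' <-> E y y')) /\
  (forall i, i < b -> In (i, i) p).

Definition swap (p : list (nat * nat)) := map (fun q => (snd q, fst q)) p.

Lemma in_swap p x y : In (x, y) (swap p) <-> In (y, x) p.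
Proof.
  unfold swap. rewrite in_map_iff. split.
  - intros ([u v] & H & K). now injection H as -> ->.
  - intros H. exists (y, x). auto.
Qed.

Lemma partial_automorphism_swap E b p :
  partial_automorphism E b p -> partial_automorphism E b (swap p).
Proof.
  intros [H1 H2]. split.
  - intros x y x' y' H H'. rewrite in_swap in H, H'.
    destruct (H1 _ _ _ _ H H'). tauto.
  - intros i Hi. rewrite in_swap. auto.
Qed.

Lemma partial_automorphism_cons E b p x y :
  Equivalence E -> partial_automorphism E b p ->
  (forall x' y', In (x', y') p -> (x = x' <-> y = y') /\ (E x x' <-> E y y')) ->
  partial_automorphism E b ((x, y) :: p).
Proof.
  intros HE [H1 H2] H. split.
  - intros u v u' v' [K|K] [K'|K'].
    + injection K as <- <-. injection K' as <- <-. split; [tauto | split; reflexivity].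
    + injection K as <- <-. auto.
    + injection K' as <- <-. destruct (H u v K) as [A B]. split.
      * split; intros ->; symmetry; now apply A.
      * split; intros C; symmetry; apply B; now symmetry.
    + auto.
  - intros i Hi. right. auto.
Qed.

(** A point of a class already met is sent into the corresponding class, which
    has the same size: a class with an element below [b] corresponds to itself,
    and the others have equal size by hypothesis.  A point of a new class is sent
    to any class that is not met by the values; one exists because equally many
    classes are met on both sides. *)
Lemma partial_automorphism_extend E b p x :
  Equivalence E -> equal_classes_off b E -> partial_automorphism E b p ->
  exists y, partial_automorphism E b ((x, y) :: p).
Proof.
  intros HE Heq Hp. pose proof Hp as [H1 H2].
  assert (dom : forall u v, In (u, v) p -> In u (map fst p)).
  { intros u v K. apply in_map_iff. now exists (u, v). }
  destruct (classic (exists y, In (x, y) p)) as [[y Hy]|Nx].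
  { exists y. apply partial_automorphism_cons; auto. }
  destruct (classic (exists x0 y0, In (x0, y0) p /\ E x0 x)) as [(x0 & y0 & H0 & Hx)|Nc].
  - assert (Hle : class_le E x0 y0).
    { destruct (classic (exists i, i < b /\ E i x0)) as [(i & Hi & K)|K].
      - assert (E x0 y0).
        { transitivity i; [now symmetry|].
          now apply (H1 i i x0 y0 (H2 i Hi) H0). }
        intros N. exists (fun u => u). intros u _ Hu. split; [|auto].
        transitivity x0; [now symmetry | assumption].
      - apply Heq; intros i Hi Ki; apply K; exists i; split; auto.
        now apply (H1 i i x0 y0 (H2 i Hi) H0). }
    destruct (list_bound (x :: map fst p)) as [N HN].
    destruct (Hle N) as [f Hf].
    (* Some element of the class of [x0], among [x] and the arguments of [p],
       is sent by [f] outside the values of [p]: otherwise [f], followed by the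
       inverse of [p], would inject these elements into those other than [x]. *)
    assert (exists u, (u = x \/ exists v, In (u, v) p) /\ E x0 u /\
              forall u', ~ In (u', f u) p) as (u & Hu & Ku & Fu).
    { apply NNPP. intros N0.
      assert (pre : forall u, exists u',
                (u = x \/ exists v, In (u, v) p) -> E x0 u -> In (u', f u) p).
      { intros u.
        destruct (classic ((u = x \/ exists v, In (u, v) p) /\ E x0 u)) as [[A B]|K];
          [|exists 0; tauto].
        apply NNPP. intros N1. apply N0. exists u. split; [|split]; auto.
        intros u' Hu'. apply N1. now exists u'. }
      set (h := fun u => proj1_sig (constructive_indefinite_description _ (pre u))).
      assert (Hh : forall u, (u = x \/ exists v, In (u, v) p) -> E x0 u ->
                In (h u, f u) p).
      { intros u. exact (proj2_sig (constructive_indefinite_description _ (pre u))). }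
      assert (Hlt : forall u, (u = x \/ exists v, In (u, v) p) -> u < N).
      { intros u [->|[v Hv]]; apply HN; [now left | right; now apply (dom u v)]. }
      set (D := fun u => E x0 u /\ exists v, In (u, v) p).
      assert (HD : forall u, u = x \/ D u -> (u = x \/ exists v, In (u, v) p) /\ E x0 u).
      { intros u [->|[A B]]; auto. }
      destruct (no_reflecting_contraction eq D (map fst p) x h) as (d & [_ [v Hv]] & <-).
      - reflexivity.
      - intros u [_ [v Hv]]. now apply (dom u v).
      - intros u Hu. apply HD in Hu as [A B]. split; [|exists (f u); auto].
        apply (H1 x0 y0 _ _ H0 (Hh u A B)). apply Hf; auto.
      - intros u v Hu Hv K. apply HD in Hu as [A B], Hv as [A' B'].
        pose proof (Hh u A B) as P. pose proof (Hh v A' B') as P'.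
        apply (proj2 (Hf v (Hlt v A') B')); auto.
        now apply (H1 _ _ _ _ P P').
      - apply Nx. now exists v. }
    assert (Huy : E y0 (f u)).
    { apply Hf; [|assumption]. destruct Hu as [->|[v Hv]]; apply HN; [now left|].
      right. now apply (dom u v). }
    exists (f u). apply partial_automorphism_cons; [assumption..|]. intros x' y' H'. split.
    + split; intros <-; exfalso; [apply Nx; eauto | now apply (Fu x')].
    + destruct (H1 x0 y0 x' y' H0 H') as [_ K]. split; intros L.
      * transitivity y0; [now symmetry|]. apply K. now transitivity x.
      * transitivity x0; [now symmetry|]. apply K. now transitivity (f u).
  - (* If the values of [p] met all classes, a choice of equivalent values,
       followed by the inverse of [p], would send the inequivalent arguments of
       [p] and [x] to inequivalent arguments of [p]. *)
    assert (exists y, forall x' y', In (x', y') p -> ~ E y y') as [y Hy].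
    { apply NNPP. intros N.
      assert (pre : forall y, exists x', exists y', In (x', y') p /\ E y y').
      { intros y. apply NNPP. intros N1. apply N. exists y. intros x' y' A B.
        apply N1. eauto. }
      set (h := fun u => proj1_sig (constructive_indefinite_description _ (pre u))).
      assert (Hh : forall u, exists y', In (h u, y') p /\ E u y').
      { intros u. exact (proj2_sig (constructive_indefinite_description _ (pre u))). }
      destruct (no_reflecting_contraction E (fun u => exists v, In (u, v) p) (map fst p) x h)
        as (d & [v Hv] & K).
      - reflexivity.
      - intros u [v Hv]. now apply (dom u v).
      - intros u _. destruct (Hh u) as (y' & A & _). eauto.
      - intros u v _ _ K. destruct (Hh u) as (y' & A & B), (Hh v) as (y'' & A' & B').
        transitivity y'; [assumption|]. transitivity y''; [|now symmetry].
        now apply (H1 _ _ _ _ A A').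
      - apply Nc. exists d, v. split; [assumption | now symmetry]. }
    exists y. apply partial_automorphism_cons; [assumption..|]. intros x' y' H'. split.
    + split; intros <-; exfalso; [apply Nx; eauto | now apply (Hy x' y H')].
    + split; intros K; exfalso; [|now apply (Hy x' y' H')].
      apply Nc. exists x', y'. split; [assumption | now symmetry].
Qed.

Lemma homogeneous_of_equal_classes E b :
  Equivalence E -> equal_classes_off b E -> homogeneous_over (seq 0 b) E.
Proof.
  intros HE Heq X Y f aX _ (_ & _ & Hinj & Hiso) Hfix.
  destruct (back_and_forth E (partial_automorphism E b)) with (p := map (fun x => (x, f x)) X)
    as (g & Hg & gp).
  - intros p [H _]. exact H.
  - intros p x Hp. now apply partial_automorphism_extend.
  - intros p y Hp.
    destruct (partial_automorphism_extend E b (swap p) y HE Heq) as [x Hx];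
      [now apply partial_automorphism_swap|].
    exists x. apply partial_automorphism_swap in Hx.
    replace ((x, y) :: p) with (swap ((y, x) :: swap p)); [exact Hx|].
    simpl. f_equal. unfold swap. rewrite map_map. rewrite <- map_id.
    apply map_ext. now intros [].
  - split.
    + intros x y x' y' H H'.
      apply in_map_iff in H as (u & [= <- <-] & Hu), H' as (v & [= <- <-] & Hv).
      split; [|now apply Hiso]. split; [now intros -> | now apply Hinj].
    + intros i Hi. assert (In i (seq 0 b)) as K by (apply in_seq; lia).
      apply in_map_iff. exists i. split; [now rewrite (Hfix i K) | now apply aX].
  - exists g. split; [assumption|]. intros x Hx. apply gp.
    apply in_map_iff. now exists x.
Qed.

Lemma ultrahomogeneous_iff E :
  Equivalence E -> ultrahomogeneous E <-> equal_classes_off 0 E.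
Proof.
  intros HE. split.
  - intros H. apply equal_classes_of_homogeneous; [assumption|].
    intros X Y f _ _ Hf _. now apply (H X Y).
  - intros H X Y f Hf. apply (homogeneous_of_equal_classes E 0 HE H X Y); trivial.
    + apply incl_nil_l.
    + apply incl_nil_l.
    + intros x [].
Qed.

Lemma equal_classes_off_ext b E E' :
  (forall u v, E u v <-> E' u v) -> equal_classes_off b E -> equal_classes_off b E'.
Proof.
  intros HE H x y Hx Hy N.
  destruct (H x y) with (N := N) as [g Hg]; [intros i Hi; rewrite HE; auto.. |].
  exists g. intros u Hu K. apply HE in K. destruct (Hg u Hu K) as [A B].
  split; [now apply HE|]. intros u' Hu' K'. apply B; [exact Hu' | now apply HE].
Qed.

(** Homogeneity over a list persists over larger lists, in particular over an
    initial segment that contains it. *)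
Lemma weakly_ultrahomogeneous_iff E :
  Equivalence E -> weakly_ultrahomogeneous E <-> exists b, equal_classes_off b E.
Proof.
  intros HE. split.
  - intros [a H]. destruct (list_bound a) as [b Hb].
    assert (I : incl a (seq 0 b)).
    { intros x Hx. apply in_seq. specialize (Hb x Hx). lia. }
    exists b. apply equal_classes_of_homogeneous; [assumption|].
    intros X Y f HX HY Hf Hfix. apply (H X Y f); auto; eapply incl_tran; eassumption.
  - intros [b H]. exists (seq 0 b). now apply homogeneous_of_equal_classes.
Qed.

(** * Upper bounds on the complexity *)

Definition homogeneity_index (v : nat) : Prop :=
  EQ (π1 v) /\ equal_classes_off (π2 v) (eqv (π1 v)).

(** The condition on [e], [b] and finitely many parameters of which the
    universal closure says that the [e]-th structure exists and has classes of
    equal size off [b].  On total characteristic functions the premises of the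
    axioms can be negated by asking for the value [0]; a finite part of the
    embedding in [class_le] is coded by [t]. *)
Definition homogeneity_matrix (e b x y z N : nat) : Prop :=
  (phi e ⟨x, y⟩ 0 \/ phi e ⟨x, y⟩ 1) /\
  phi e ⟨x, x⟩ 1 /\
  (phi e ⟨x, y⟩ 0 \/ phi e ⟨y, x⟩ 1) /\
  (phi e ⟨x, y⟩ 0 \/ phi e ⟨y, z⟩ 0 \/ phi e ⟨x, z⟩ 1) /\
  ((exists i, i < b /\ phi e ⟨i, x⟩ 1) \/ (exists i, i < b /\ phi e ⟨i, y⟩ 1) \/
   exists t, forall u, u < N ->
     phi e ⟨x, u⟩ 0 \/
     (phi e ⟨y, entry t u⟩ 1 /\
      forall u', u' < N -> phi e ⟨x, u'⟩ 0 \/ entry t u' <> entry t u \/ u' = u)).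

Lemma homogeneity_index_iff v :
  homogeneity_index v <->
  forall p, homogeneity_matrix (π1 v) (π2 v)
    (π1 p) (π1 (π2 p)) (π1 (π2 (π2 p))) (π2 (π2 (π2 p))).
Proof.
  unfold homogeneity_index. set (e := π1 v). set (b := π2 v).
  transitivity (forall x y z N, homogeneity_matrix e b x y z N).
  2:{ split; [intros H p; apply H|]. intros H x y z N.
      specialize (H ⟨x, ⟨y, ⟨z, N⟩⟩⟩). now rewrite !π2_pair, !π1_pair in H. }
  assert (contra : forall w, phi e w 0 -> phi e w 1 -> False).
  { intros w H0 H1. discriminate (phi_functional _ _ _ H0 _ H1). }
  unfold homogeneity_matrix. split.
  - intros [[tot [R S T]] H] x y z N. unfold eqv in R, S, T, H. repeat split.
    + apply tot.
    + apply R.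
    + destruct (tot x y) as [K|K]; [now left | right; now apply S].
    + destruct (tot x y) as [K|K]; [now left|].
      destruct (tot y z) as [K'|K']; [now right; left|]. right; right. now apply T with y.
    + destruct (classic (exists i, i < b /\ phi e ⟨i, x⟩ 1)) as [K|K]; [now left|].
      destruct (classic (exists i, i < b /\ phi e ⟨i, y⟩ 1)) as [K'|K']; [now right; left|].
      right; right.
      destruct (H x y) with (N := N) as [f Hf]; [intros i Hi C; eauto..|].
      destruct (entry_realizes f N) as [t Ht]. exists t. intros u Hu.
      destruct (tot x u) as [C|C]; [now left|]. right.
      destruct (Hf u Hu C) as [A B]. rewrite Ht by assumption. split; [assumption|].
      intros u' Hu'. destruct (tot x u') as [C'|C']; [now left|]. right.
      rewrite Ht by assumption.
      destruct (Nat.eq_dec (f u') (f u)); [right; auto | now left].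
  - intros H.
    assert (tot : forall x y, phi e ⟨x, y⟩ 0 \/ phi e ⟨x, y⟩ 1).
    { intros x y. apply (H x y 0 0). }
    split; [split; [exact tot | split]|].
    + intros x. apply (H x 0 0 0).
    + intros x y K. destruct (H x y 0 0) as (_ & _ & [C|C] & _); [|exact C].
      now destruct (contra _ C K).
    + intros x y z K K'. destruct (H x y z 0) as (_ & _ & _ & [C|[C|C]] & _);
        [now destruct (contra _ C K) | now destruct (contra _ C K') | exact C].
    + intros x y Hx Hy N.
      destruct (H x y 0 N) as (_ & _ & _ & _ & [(i & Hi & C)|[(i & Hi & C)|[t Ht]]]);
        [now destruct (Hx i Hi C) | now destruct (Hy i Hi C)|].
      exists (entry t). intros u Hu K.
      destruct (Ht u Hu) as [C|[A B]]; [now destruct (contra _ C K)|].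
      split; [exact A|]. intros u' Hu' K' Q.
      destruct (B u' Hu') as [C|[C|C]]; [now destruct (contra _ C K') | now destruct C | exact C].
Qed.

Lemma sd_homogeneity_matrix :
  semidecidable (fun w => homogeneity_matrix (π1 (π1 w)) (π2 (π1 w))
    (π1 (π2 w)) (π1 (π2 (π2 w))) (π1 (π2 (π2 (π2 w)))) (π2 (π2 (π2 (π2 w))))).
Proof. unfold homogeneity_matrix. semidecidability; apply sd_phi; computability. Qed.

Lemma Pi2_homogeneity_index : Pi0 2 homogeneity_index.
Proof.
  eexists. split; [exact sd_homogeneity_matrix|].
  intros v. rewrite homogeneity_index_iff.
  split; intros H p; specialize (H p); [now rewrite !π1_pair, !π2_pair|].
  now rewrite !π1_pair, !π2_pair in H.
Qed.

Lemma Pi2_subst A f : Pi0 2 A -> computable f -> Pi0 2 (fun v => A (f v)).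
Proof.
  intros (B & HB & HA) Hf. exists (fun w => B ⟨f (π1 w), π2 w⟩). split.
  - apply (sd_subst B (fun w => ⟨f (π1 w), π2 w⟩) HB). apply computable_pair; [|computability].
    apply computable_comp; computability.
  - intros v. rewrite HA. split; intros H p; specialize (H p).
    + now rewrite π1_pair, π2_pair.
    + now rewrite π1_pair, π2_pair in H.
Qed.

Lemma UHQ_iff e : UHQ e <-> homogeneity_index ⟨e, 0⟩.
Proof.
  unfold UHQ, homogeneity_index. rewrite π1_pair, π2_pair.
  split; intros [HE H]; (split; [exact HE|]); now apply ultrahomogeneous_iff; [apply HE|].
Qed.

Lemma WUQ_iff e : WUQ e <-> exists b, homogeneity_index ⟨e, b⟩.
Proof.
  unfold WUQ, homogeneity_index. split.
  - intros [HE H]. apply weakly_ultrahomogeneous_iff in H as [b Hb]; [|apply HE].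
    exists b. now rewrite π1_pair, π2_pair.
  - intros [b H]. rewrite π1_pair, π2_pair in H. destruct H as [HE H]. split; [exact HE|].
    apply weakly_ultrahomogeneous_iff; [apply HE | now exists b].
Qed.

Lemma Pi2_UHQ : Pi0 2 UHQ.
Proof.
  destruct (Pi2_subst homogeneity_index (fun e => ⟨e, 0⟩) Pi2_homogeneity_index)
    as (B & HB & H); [computability|].
  exists B. split; [exact HB|]. intros e. rewrite UHQ_iff. apply H.
Qed.

Lemma Sigma3_WUQ : Sigma0 3 WUQ.
Proof. exists homogeneity_index. split; [exact Pi2_homogeneity_index | exact WUQ_iff]. Qed.

(** * Infinite sets *)

Definition infinite (A : nat -> Prop) : Prop := forall N, exists t, N <= t /\ A t.

Lemma infinite_enum A :
  infinite A -> exists f : nat -> nat, Injective f /\ forall n, A (f n).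
Proof.
  intros HA.
  set (next := fun N => proj1_sig (constructive_indefinite_description _ (HA N))).
  assert (Hnext : forall N, N <= next N /\ A (next N)).
  { intros N. exact (proj2_sig (constructive_indefinite_description _ (HA N))). }
  set (f := nat_rect (fun _ => nat) (next 0) (fun _ r => next (1 + r))).
  assert (lt : forall m n, m < n -> f m < f n).
  { intros m n Hmn. induction Hmn as [|n Hmn IH]; simpl.
    - apply Hnext.
    - specialize (proj1 (Hnext (1 + f n))). simpl. lia. }
  exists f. split.
  - intros m n Hmn. destruct (Nat.lt_trichotomy m n) as [L|[L|L]]; [|exact L|];
      apply lt in L; lia.
  - intros [|n]; apply Hnext.
Qed.

Lemma class_le_of_infinite (E : nat -> nat -> Prop) x y : infinite (E y) -> class_le E x y.
Proof.
  intros H N. apply infinite_enum in H as (f & Hinj & Hf).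
  exists f. intros u _ _. split; [apply Hf|]. intros u' _ _. apply Hinj.
Qed.

(** Embeddings of [M + 1] elements of the first class cannot all have their
    values below [M]. *)
Lemma infinite_of_class_le (E : nat -> nat -> Prop) x y :
  class_le E x y -> infinite (E x) -> infinite (E y).
Proof.
  intros Hle H M. apply infinite_enum in H as (g & Hinj & Hg).
  destruct (list_bound (map g (seq 0 (S M)))) as [N HN].
  destruct (Hle N) as [f Hf].
  assert (lt : forall i, i <= M -> g i < N).
  { intros i Hi. apply HN, in_map, in_seq. lia. }
  apply NNPP. intros K.
  assert (ND : NoDup (map (fun i => f (g i)) (seq 0 (S M)))).
  { apply NoDup_map_NoDup_ForallPairs; [|apply seq_NoDup].
    intros i j Hi Hj Hij. apply in_seq in Hi, Hj. apply Hinj.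
    apply (proj2 (Hf (g j) (lt j ltac:(lia)) (Hg j))); [apply lt; lia | apply Hg | exact Hij]. }
  apply NoDup_incl_length with (l' := seq 0 M) in ND.
  - rewrite length_map, !length_seq in ND. lia.
  - intros u Hu. apply in_map_iff in Hu as (i & <- & Hi). apply in_seq in Hi.
    apply in_seq. destruct (Nat.lt_ge_cases (f (g i)) M); [lia|].
    exfalso. apply K. exists (f (g i)). split; [assumption|]. apply Hf; [|apply Hg].
    apply lt. lia.
Qed.

(** The normal form of $\Pi^0_2$ sets: the initial segments of witnesses, each
    with the least bound that covers it, are infinitely many if and only if
    every [y] has a witness.  The empty segment makes the set nonempty, and
    leastness of the bound leaves infinitely many numbers out. *)
Lemma Pi2_infinite P :
  Pi0 2 P ->
  exists D, computable_set D /\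
    (forall v, P v <-> infinite (fun t => D ⟨v, t⟩)) /\
    (forall v, D ⟨v, ⟨0, 0⟩⟩).
Proof.
  intros (Q & (B & HB & HQ) & HP). cbn in HB.
  set (F := fun v n s => forall y, y < n -> exists z, z < s /\ B ⟨⟨v, y⟩, z⟩).
  assert (HPF : forall v, P v <-> forall n, exists s, F v n s).
  { intros v. rewrite HP. split.
    - intros H n. unfold F.
      apply (collection (fun y s => exists z, z < s /\ B ⟨⟨v, y⟩, z⟩)).
      + intros y m m' Hm (z & Hz & K). exists z. split; [lia | exact K].
      + intros y _. specialize (H y). apply HQ in H as [z Hz]. exists (S z), z. auto.
    - intros H y. apply HQ. destruct (H (S y)) as [s Hs].
      destruct (Hs y) as (z & _ & Hz); [lia | eauto]. }
  exists (fun w => F (π1 w) (π1 (π2 w)) (π2 (π2 w)) /\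
            forall s, s < π2 (π2 w) -> ~ F (π1 w) (π1 (π2 w)) s).
  split; [unfold F; decidability|]. split.
  - intros v. rewrite HPF. split.
    + intros H N.
      destruct (dec_inh_nat_subset_has_unique_least_element (F v N))
        as (s & [Hs Hmin] & _); [intros s; apply classic | apply H |].
      exists ⟨N, s⟩. split; [apply pair_le_l|].
      rewrite !π2_pair, !π1_pair. split; [exact Hs|].
      intros s' Hs' K. apply Hmin in K. lia.
    + intros H n.
      (* Each [m < n] occurs with at most one bound, so these pairs are bounded
         and some pair beyond the bound covers [n]. *)
      destruct (collection (fun m M => forall s,
          F v m s -> (forall s', s' < s -> ~ F v m s') -> ⟨m, s⟩ < M) n) as [M HM].
      * intros m M M' HM K s H1 H2. specialize (K s H1 H2). lia.
      * intros m _. destruct (classic (exists s, F v m s /\ forall s', s' < s -> ~ F v m s'))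
          as [(s & H1 & H2)|K].
        -- exists (S ⟨m, s⟩). intros s' H1' H2'.
           replace s' with s; [lia|].
           destruct (Nat.lt_trichotomy s s') as [L|[L|L]]; [|exact L|].
           ++ now destruct (H2' s L).
           ++ now destruct (H2 s' L).
        -- exists 0. intros s H1 H2. exfalso. eauto.
      * destruct (H M) as (t & Ht & H1 & H2).
        rewrite !π2_pair, !π1_pair in H1. rewrite !π2_pair, π1_pair in H2.
        destruct (Nat.lt_ge_cases (π1 t) n) as [L|L].
        -- specialize (HM (π1 t) L (π2 t) H1 H2). rewrite pair_π in HM. lia.
        -- exists (π2 t). intros y Hy. apply H1. lia.
  - intros v. rewrite !π2_pair, !π1_pair. split; [intros y Hy; lia | intros s Hs; lia].
Qed.

(** * The structures of columns split in two *)

(** Two classes per column: that of [C w] is the one whose size is controlled,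
    while its complement will always be infinite and serves as a standard of
    comparison. *)
Definition split_columns (C : nat -> nat -> Prop) (u v : nat) : Prop :=
  π1 u = π1 v /\ (C (π1 u) (π2 u) <-> C (π1 v) (π2 v)).

Lemma split_columns_equivalence C : Equivalence (split_columns C).
Proof.
  unfold split_columns. split.
  - intros u. split; tauto.
  - intros u v []. split; [congruence | tauto].
  - intros u v w [] []. split; [congruence | tauto].
Qed.

Lemma infinite_column_class C w i :
  infinite (split_columns C ⟨w, i⟩) <-> infinite (fun t => C w i <-> C w t).
Proof.
  unfold split_columns. split; intros H N.
  - (* A bound that exceeds all pairs of [w] with a number below [N]. *)
    destruct (list_bound (map (fun t => ⟨w, t⟩) (seq 0 N))) as [M HM].
    destruct (H M) as (u & Hu & H1 & H2). rewrite π1_pair, π2_pair in *.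
    exists (π2 u). rewrite H1. split; [|now rewrite <- H1 at 1].
    destruct (Nat.lt_ge_cases (π2 u) N) as [L|L]; [|exact L]. exfalso.
    assert (u < M); [|lia]. apply HM. apply in_map_iff. exists (π2 u). split.
    + rewrite H1. apply pair_π.
    + apply in_seq. lia.
  - destruct (H N) as (t & Ht & K). exists ⟨w, t⟩. rewrite !π1_pair, !π2_pair.
    pose proof (pair_le_r w t). repeat split; [lia | apply K..].
Qed.

(** Since [w <= ⟨w, i⟩], no class of a column [w >= b] has an element below
    [b], and the two classes of the column can be compared. *)
Lemma equal_classes_off_columns C b w :
  (forall w, exists i, C w i) -> (forall w, infinite (fun i => ~ C w i)) ->
  equal_classes_off b (split_columns C) -> b <= w -> infinite (C w).
Proof.
  intros Hne Hco H Hw. destruct (Hne w) as [i Hi], (Hco w 0) as (j & _ & Hj).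
  assert (off : forall k c, c < b -> ~ split_columns C c ⟨w, k⟩).
  { intros k c Hc [K _]. rewrite π1_pair in K.
    pose proof (pair_le_l (π1 c) (π2 c)). rewrite pair_π in *. lia. }
  assert (K : infinite (split_columns C ⟨w, i⟩)).
  { apply (infinite_of_class_le _ ⟨w, j⟩); [apply H; apply off|].
    apply infinite_column_class. intros N. destruct (Hco w N) as (t & Ht & K).
    exists t. tauto. }
  apply infinite_column_class in K. intros N. destruct (K N) as (t & Ht & L).
  exists t. tauto.
Qed.

(** Each of the first [w0] columns has at most two classes, so some [b] exceeds
    an element of each of them; only infinite classes are left off [b]. *)
Lemma equal_classes_off_of_columns C w0 :
  (forall w, infinite (fun i => ~ C w i)) -> (forall w, w0 <= w -> infinite (C w)) ->
  exists b, equal_classes_off b (split_columns C) /\ (w0 = 0 -> b = 0).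
Proof.
  intros Hco H. destruct w0 as [|w1].
  - exists 0. split; [|reflexivity]. intros x y _ _. apply class_le_of_infinite.
    rewrite <- (pair_π y). apply infinite_column_class. intros N.
    destruct (classic (C (π1 y) (π2 y))) as [K|K].
    + destruct (H (π1 y) (Nat.le_0_l _) N) as (t & Ht & L). exists t. tauto.
    + destruct (Hco (π1 y) N) as (t & Ht & L). exists t. tauto.
  - set (w0 := S w1) in *.
    (* A bound below which all classes of the first [w0] columns are met. *)
    destruct (collection (fun w b => forall x, π1 x = w -> exists i, i < b /\ split_columns C i x)
                w0) as [b Hb].
    + intros w m m' Hm K x Hx. destruct (K x Hx) as (i & Hi & L). exists i. split; [lia | exact L].
    + intros w _. destruct (classic (exists i, C w i)) as [[i Hi]|K].
      * destruct (Hco w 0) as (j & _ & Hj). exists (S (⟨w, i⟩ + ⟨w, j⟩)). intros x <-.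
        unfold split_columns. destruct (classic (C (π1 x) (π2 x))).
        -- exists ⟨π1 x, i⟩. rewrite π1_pair, π2_pair. split; [lia | tauto].
        -- exists ⟨π1 x, j⟩. rewrite π1_pair, π2_pair. split; [lia | tauto].
      * exists (S ⟨w, 0⟩). intros x <-. exists ⟨π1 x, 0⟩. unfold split_columns.
        rewrite π1_pair, π2_pair. split; [lia|]. split; [reflexivity|].
        split; intros L; exfalso; eauto.
    + exists b. split; [|discriminate]. intros x y _ Hy. apply class_le_of_infinite.
      assert (Ly : w0 <= π1 y).
      { apply Nat.nlt_ge. intros L. destruct (Hb _ L y eq_refl) as (i & Hi & K).
        now apply (Hy i Hi). }
      rewrite <- (pair_π y). apply infinite_column_class. intros N.
      destruct (classic (C (π1 y) (π2 y))) as [K|K].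
      * destruct (H (π1 y) Ly N) as (t & Ht & L). exists t. tauto.
      * destruct (Hco (π1 y) N) as (t & Ht & L). exists t. tauto.
Qed.

(** * Hardness *)

Lemma split_columns_index C3 :
  computable_set C3 ->
  exists f, computable f /\
    forall x, EQ (f x) /\
      forall u v, eqv (f x) u v <-> split_columns (fun w i => C3 ⟨x, ⟨w, i⟩⟩) u v.
Proof.
  intros HC.
  assert (HS : computable_set (fun s => split_columns (fun w i => C3 ⟨π1 s, ⟨w, i⟩⟩)
                                 (π1 (π2 s)) (π2 (π2 s)))).
  { unfold split_columns. decidability. }
  destruct HS as (h & Hh & HS). destruct (smn h Hh) as (f & Hf & Hphi).
  exists f. split; [exact Hf|]. intros x.
  assert (H : forall u v, eqv (f x) u v <-> split_columns (fun w i => C3 ⟨x, ⟨w, i⟩⟩) u v).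
  { intros u v. unfold eqv. specialize (Hphi x ⟨u, v⟩). specialize (HS ⟨x, ⟨u, v⟩⟩).
    cbv beta in HS. rewrite !π2_pair, !π1_pair in HS.
    destruct HS as [[K L]|[K L]]; rewrite L in Hphi.
    - tauto.
    - split; [|tauto]. intros M. discriminate (phi_functional _ _ _ Hphi _ M). }
  split; [|exact H]. split.
  - intros u v. specialize (Hphi x ⟨u, v⟩).
    destruct (HS ⟨x, ⟨u, v⟩⟩) as [[_ L]|[_ L]]; rewrite L in Hphi; auto.
  - destruct (split_columns_equivalence (fun w i => C3 ⟨x, ⟨w, i⟩⟩)) as [R S T]. split.
    + intros u. apply H. apply R.
    + intros u v K. apply H. apply S. now apply H.
    + intros u v w K L. apply H. apply T with v; now apply H.
Qed.

(** The part [C w] collects the [t] in [D] for all [w' <= w].  By taking them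
    cumulatively a single [w'] in [P] makes cofinitely many columns infinite,
    and pairs with [w' > w] keep the complement infinite. *)
Theorem homogeneity_hard P :
  Pi0 2 P ->
  exists f, computable f /\ forall x, EQ (f x) /\
    (UHQ (f x) <-> P ⟨x, 0⟩) /\ (WUQ (f x) <-> exists w, P ⟨x, w⟩).
Proof.
  intros HP. destruct (Pi2_infinite P HP) as (D & HD & HPD & D0).
  set (C3 := fun s => π1 (π2 (π2 s)) <= π1 (π2 s) /\
                      D ⟨⟨π1 s, π1 (π2 (π2 s))⟩, π2 (π2 (π2 s))⟩).
  destruct (split_columns_index C3) as (f & Hf & HE); [unfold C3; decidability|].
  exists f. split; [exact Hf|]. intros x. destruct (HE x) as [Hx Heqv]. clear HE.
  split; [exact Hx|].
  set (C := fun w i => C3 ⟨x, ⟨w, i⟩⟩) in *.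
  assert (HC : forall w i, C w i <-> π1 i <= w /\ D ⟨⟨x, π1 i⟩, π2 i⟩).
  { intros w i. unfold C, C3. now rewrite !π2_pair, !π1_pair. }
  assert (Hne : forall w, exists i, C w i).
  { intros w. exists ⟨0, ⟨0, 0⟩⟩. apply HC. rewrite π1_pair, π2_pair. split; [lia | apply D0]. }
  assert (Hco : forall w, infinite (fun i => ~ C w i)).
  { intros w N. exists ⟨S w, N⟩. split; [apply pair_le_r|]. rewrite HC, π1_pair. lia. }
  assert (Hinf : forall w, infinite (C w) <-> exists w', w' <= w /\ P ⟨x, w'⟩).
  { intros w. split.
    - intros H. apply NNPP. intros K.
      destruct (collection (fun w' M => forall t, D ⟨⟨x, w'⟩, t⟩ -> ⟨w', t⟩ < M) (S w))
        as [M HM].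
      + intros w' m m' Hm L t Ht. specialize (L t Ht). lia.
      + intros w' Hw'. assert (N : ~ P ⟨x, w'⟩) by (intros L; apply K; exists w'; split; [lia | exact L]).
        rewrite HPD in N. apply not_all_ex_not in N as [N HN].
        destruct (list_bound (map (fun t => ⟨w', t⟩) (seq 0 N))) as [M HM]. exists M.
        intros t Ht. apply HM. apply (in_map (fun t => ⟨w', t⟩)), in_seq. split; [lia|].
        destruct (Nat.lt_ge_cases t N) as [L|L]; [exact L|]. exfalso. eauto.
      + destruct (H M) as (i & Hi & L). apply HC in L as [L1 L2].
        specialize (HM (π1 i) ltac:(lia) _ L2). rewrite pair_π in HM. lia.
    - intros (w' & Hw' & K) N. apply HPD in K. destruct (K N) as (t & Ht & L).
      exists ⟨w', t⟩. pose proof (pair_le_r w' t). split; [lia|].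
      apply HC. rewrite π1_pair, π2_pair. auto. }
  assert (Hoff : forall b, equal_classes_off b (eqv (f x)) <->
                           equal_classes_off b (split_columns C)).
  { intros b. split; apply equal_classes_off_ext; [exact Heqv | now symmetry]. }
  unfold UHQ, WUQ.
  rewrite (ultrahomogeneous_iff _ (proj2 Hx)), (weakly_ultrahomogeneous_iff _ (proj2 Hx)).
  split.
  - rewrite Hoff. split.
    + intros [_ H]. apply equal_classes_off_columns with (w := 0) in H; auto.
      apply Hinf in H as (w & Hw & K). now replace w with 0 in K by lia.
    + intros K. split; [exact Hx|].
      destruct (equal_classes_off_of_columns C 0 Hco) as (b & Hb & E).
      * intros w _. apply Hinf. exists 0. split; [lia | exact K].
      * now rewrite E in Hb.
  - split.
    + intros [_ [b H]]. apply Hoff, equal_classes_off_columns with (w := b) in H; auto.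
      apply Hinf in H as (w & _ & K). now exists w.
    + intros [w0 K]. split; [exact Hx|].
      destruct (equal_classes_off_of_columns C w0 Hco) as (b & Hb & _).
      * intros w Hw. apply Hinf. now exists w0.
      * exists b. now apply Hoff.
Qed.

Lemma complete_of_relative Gamma B C :
  Gamma B -> (forall i, B i -> C i) ->
  (forall A, Gamma A ->
     exists f, computable f /\ (forall i, C (f i)) /\ forall i, A i <-> B (f i)) ->
  complete Gamma B /\ complete_relative Gamma B C.
Proof.
  intros HB HBC H. split; split.
  - exact HB.
  - intros A HA. destruct (H A HA) as (f & Hf & _ & K). eauto.
  - exists B. split; [exact HB|]. intros i. split; [auto | tauto].
  - exact H.
Qed.

Theorem theorem4p5 :
  (complete (Pi0 2) UHQ /\ complete_relative (Pi0 2) UHQ EQ) /\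
  (complete (Sigma0 3) WUQ /\ complete_relative (Sigma0 3) WUQ EQ).
Proof.
  split; apply complete_of_relative.
  - exact Pi2_UHQ.
  - now intros e [].
  - intros A HA.
    destruct (homogeneity_hard (fun v => A (π1 v))) as (f & Hf & K).
    + apply Pi2_subst; [exact HA | computability].
    + exists f. split; [exact Hf|]. split; [apply K|].
      intros i. destruct (K i) as (_ & E & _). rewrite E. now rewrite π1_pair.
  - exact Sigma3_WUQ.
  - now intros e [].
  - intros A (P & HP & HA). destruct (homogeneity_hard P HP) as (f & Hf & K).
    exists f. split; [exact Hf|]. split; [apply K|].
    intros i. destruct (K i) as (_ & _ & E). rewrite HA. now symmetry.
Qed.
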